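(* Let $p$ be a prime, let $d_x$ be a positive integer, let $w\geq d_x+1$ be an integer and let $f:\mathbb Z_p^{d_x}\to\mathbb Q_p$ be a locally constant function. Then there is a $\mathrm{pReLU}$-network $g:\mathbb Q_p^{d_x}\to\mathbb Q_p$ of width $w$ which computes $f$, i.e. $g(x)=f(x)$ for all $x\in\mathbb Z_p^{d_x}$.
   Context: $\mathbb Q_p$ denotes the $p$-adic numbers and $\mathbb Z_p$ the $p$-adic integers (with their usual topology). A function $f:X\to Y$ between topological spaces is locally constant if every point of $X$ has an open neighbourhood on which $f$ is constant. The function $\mathrm{pReLU}:\mathbb Q_p\to\mathbb Q_p$ is defined by $\mathrm{pReLU}(x)=x$ if $x\in\mathbb Z_p$ and $0$ otherwise. A $\mathrm{pReLU}$-network with input dimension $d_x$, output dimension $d_y$ and hidden layer dimensions $d_1,\dots,d_{L-1}$ is a composition $t_L\circ\Sigma_{L-1}\circ t_{L-1}\circ\cdots\circ t_2\circ\Sigma_1\circ t_1:\mathbb Q_p^{d_x}\to\mathbb Q_p^{d_y}$, where (with $d_0=d_x$, $d_L=d_y$) each $t_l:\mathbb Q_p^{d_{l-1}}\to\mathbb Q_p^{d_l}$ is an affine map with coefficients in $\mathbb Q_p$ and $\Sigma_l$ applies $\mathrm{pReLU}$ to each coordinate. Its width is $\max(d_1,\dots,d_{L-1})$. *)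

(* Defs.v *)
From HB Require Import structures.
From mathcomp Require Import all_boot all_order all_algebra.
From mathcomp Require Import all_classical.
From mathcomp Require Import topology.

Set Implicit Arguments.
Unset Strict Implicit.
Unset Printing Implicit Defensive.

Import Order.TTheory GRing.Theory Num.Theory.

Local Open Scope classical_set_scope.
Local Open Scope ring_scope.

(* The p-adic integers, as the inverse limit of the rings Z/p^n: [x n] is the
   representative in [0, p^n) of the class of x modulo p^n (the range is forced
   by the compatibility condition). The primality proof is a parameter of the
   type so that the integral domain structure can be inferred from it. *)
Record padic_int (p : nat) (p_pr : prime p) := PadicInt {
  padic_res :> nat -> int ;
  _ : `[< forall n, (padic_res n.+1 %% p%:Z ^+ n)%Z = padic_res n >]
}.

HB.instance Definition _ p (p_pr : prime p) :=
  [isSub for @padic_res p p_pr].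
HB.instance Definition _ p (p_pr : prime p) :=
  [Choice of padic_int p_pr by <:].

Section PadicIntRing.
Variables (p : nat) (p_pr : prime p).
Local Notation Zp := (padic_int p_pr).
Implicit Types (x y z : Zp) (n m : nat).

Lemma padic_resS x n : (x n.+1 %% p%:Z ^+ n)%Z = x n.
Proof. by case: x => u /= /asboolP. Qed.

Lemma padic_int_inj x y : (forall n, x n = y n) -> x = y.
Proof. by move=> xy; apply/val_inj/funext. Qed.

Lemma dvdz_mod0E (d a : int) : (d %| a)%Z = ((a %% d)%Z == 0).
Proof. exact: sameP dvdz_mod0P eqP. Qed.

Lemma modz_modd (a d e : int) : (d %| e)%Z -> ((a %% e)%Z = a %[mod d])%Z.
Proof.
move=> de; apply/eqP; rewrite eqz_mod_dvd {2}(divz_eq a e) opprD addrCA subrr.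
by rewrite addr0 dvdzE abszN -dvdzE dvdz_mull.
Qed.

Lemma modz_expSn (a : int) n :
  ((a %% p%:Z ^+ n.+1)%Z = a %[mod p%:Z ^+ n])%Z.
Proof. by rewrite modz_modd // exprS dvdz_mull. Qed.

Lemma padic_res_mod x n : (x n %% p%:Z ^+ n)%Z = x n.
Proof. by rewrite -padic_resS modz_mod. Qed.

Lemma padic_resD x n m : (x (n + m)%N %% p%:Z ^+ n)%Z = x n.
Proof.
elim: m => [|m IHm]; first by rewrite addn0 padic_res_mod.
rewrite -IHm addnS -[in RHS]padic_resS modz_modd //.
by rewrite exprD dvdz_mulr.
Qed.

Fact padic_of_subproof (u : nat -> int) :
  (forall n, (u n.+1 = u n %[mod p%:Z ^+ n])%Z) ->
  `[< forall n, ((fun k => (u k %% p%:Z ^+ k)%Z) n.+1 %% p%:Z ^+ n)%Z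
                = (fun k => (u k %% p%:Z ^+ k)%Z) n >].
Proof. by move=> uP; apply/asboolP => n /=; rewrite modz_expSn uP. Qed.

Definition padic_of u uP : Zp := PadicInt p_pr (@padic_of_subproof u uP).

Fact padic_const_subproof (a : int) n : (a = a %[mod p%:Z ^+ n])%Z.
Proof. by []. Qed.

Fact padic_opp_subproof x n :
  (- x n.+1 = - x n %[mod p%:Z ^+ n])%Z.
Proof. by rewrite -modzNm padic_resS. Qed.

Fact padic_add_subproof x y n :
  (x n.+1 + y n.+1 = x n + y n %[mod p%:Z ^+ n])%Z.
Proof. by rewrite -modzDm !padic_resS. Qed.

Fact padic_mul_subproof x y n :
  (x n.+1 * y n.+1 = x n * y n %[mod p%:Z ^+ n])%Z.
Proof. by rewrite -modzMm !padic_resS. Qed.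

Definition padic_of_int (a : int) : Zp :=
  @padic_of (fun=> a) (padic_const_subproof a).
Definition padic_opp x : Zp := padic_of (padic_opp_subproof x).
Definition padic_add x y : Zp := padic_of (padic_add_subproof x y).
Definition padic_mul x y : Zp := padic_of (padic_mul_subproof x y).

Fact padic_addA : associative padic_add.
Proof.
by move=> x y z; apply: padic_int_inj => n /=; rewrite modzDml modzDmr addrA.
Qed.

Fact padic_addC : commutative padic_add.
Proof. by move=> x y; apply: padic_int_inj => n /=; rewrite addrC. Qed.

Fact padic_add0 : left_id (padic_of_int 0) padic_add.
Proof.
by move=> x; apply: padic_int_inj => n /=; rewrite mod0z add0r padic_res_mod.
Qed.

Fact padic_addN : left_inverse (padic_of_int 0) padic_opp padic_add.
Proof. by move=> x; apply: padic_int_inj => n /=; rewrite modzDml addNr. Qed.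

HB.instance Definition _ := GRing.isZmodule.Build (padic_int p_pr)
  padic_addA padic_addC padic_add0 padic_addN.

Fact padic_mulA : associative padic_mul.
Proof.
by move=> x y z; apply: padic_int_inj => n /=; rewrite modzMml modzMmr mulrA.
Qed.

Fact padic_mulC : commutative padic_mul.
Proof. by move=> x y; apply: padic_int_inj => n /=; rewrite mulrC. Qed.

Fact padic_mul1 : left_id (padic_of_int 1) padic_mul.
Proof.
move=> x; apply: padic_int_inj => n /=.
by rewrite modzMml mul1r padic_res_mod.
Qed.

Fact padic_mulDl : left_distributive padic_mul padic_add.
Proof.
move=> x y z; apply: padic_int_inj => n /=.
by rewrite modzMml modzDm mulrDl.
Qed.

Fact padic_1neq0 : padic_of_int 1 != 0.
Proof.
apply/eqP => /(congr1 (fun x : Zp => x 1%N)) /=.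
by rewrite expr1 mod0z modz_small //= ltz_nat prime_gt1.
Qed.

HB.instance Definition _ := GRing.Zmodule_isComNzRing.Build (padic_int p_pr)
  padic_mulA padic_mulC padic_mul1 padic_mulDl padic_1neq0.

Definition padic_unit : pred Zp := fun x => `[< exists y, y * x = 1 >].

Definition padic_inv x : Zp :=
  if pselect (exists y, y * x = 1) is left h then projT1 (cid h) else x.

Fact padic_mulVx : {in padic_unit, left_inverse 1 padic_inv *%R}.
Proof.
move=> x /asboolP xu; rewrite /padic_inv; case: pselect => // h.
exact: (projT2 (cid h)).
Qed.

Fact padic_unitP x y : y * x = 1 -> padic_unit x.
Proof. by move=> yx; apply/asboolP; exists y. Qed.

Fact padic_inv_out : {in [predC padic_unit], padic_inv =1 id}.
Proof.
move=> x xNu; rewrite /padic_inv; case: pselect => // h.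
by case/negP: xNu; apply/asboolP.
Qed.

HB.instance Definition _ := GRing.ComNzRing_hasMulInverse.Build
  (padic_int p_pr) padic_mulVx padic_unitP padic_inv_out.

Lemma padic_res0 n : (0 : Zp) n = 0. Proof. exact: mod0z. Qed.
Lemma padic_res_add x y n : (x + y) n = ((x n + y n) %% p%:Z ^+ n)%Z.
Proof. by []. Qed.
Lemma padic_res_opp x n : (- x) n = (- x n %% p%:Z ^+ n)%Z.
Proof. by []. Qed.
Lemma padic_res_mul x y n : (x * y) n = ((x n * y n) %% p%:Z ^+ n)%Z.
Proof. by []. Qed.

Lemma padic_neq0P x : x != 0 -> exists n, x n != 0.
Proof.
move=> x0; apply: contrapT => /forallNP xn0; case/eqP: x0.
apply: padic_int_inj => n; rewrite padic_res0.
by apply/eqP/negPn/negP; exact: xn0.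
Qed.

Lemma ndvdz_expD (a b : int) n m :
  ~~ (p%:Z ^+ n %| a)%Z -> ~~ (p%:Z ^+ m %| b)%Z ->
  ~~ (p%:Z ^+ (n + m) %| a * b)%Z.
Proof.
rewrite !dvdzE !abszX abszM /= => na nb.
have a0 : (0 < `|a|)%N by rewrite lt0n; apply: contra na => /eqP->.
have b0 : (0 < `|b|)%N by rewrite lt0n; apply: contra nb => /eqP->.
move: na nb; rewrite !pfactor_dvdn ?muln_gt0 ?a0 // lognM // -!ltnNge => na nb.
by rewrite (leq_trans (n := (logn p `|a|).+1 + logn p `|b|)) // ?leq_add // ltnW.
Qed.

Fact padic_mulf_eq0 x y : x * y = 0 -> (x == 0) || (y == 0).
Proof.
apply: contra_eqT; rewrite negb_or => /andP[/padic_neq0P[n xn] /padic_neq0P[m ym]].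
apply/eqP => /(congr1 (fun z : Zp => z (n + m)%N)).
rewrite padic_res_mul padic_res0 => /eqP; apply/negP; rewrite -dvdz_mod0E.
apply: ndvdz_expD; first by rewrite dvdz_mod0E padic_resD.
by rewrite addnC dvdz_mod0E padic_resD.
Qed.

HB.instance Definition _ := GRing.ComUnitRing_isIntegral.Build
  (padic_int p_pr) padic_mulf_eq0.

End PadicIntRing.

Section PadicIntTopology.
Local Open Scope relation_scope.
Variables (p : nat) (p_pr : prime p).
Local Notation Zp := (padic_int p_pr).

(* The uniform structure of the p-adic metric, which is also the one of the
   inverse limit of the discrete spaces Z/p^n (see [padic_res_eqP]). *)
Definition padic_ent : set_system (Zp * Zp) :=
  [set A | exists n, forall x y : Zp, x n = y n -> A (x, y)].

Fact padic_ent_filter : Filter padic_ent.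
Proof.
split; first by exists 0%N.
- move=> A B [n An] [m Bm]; exists (n + m)%N => x y xy; split.
    by apply: An; rewrite -(padic_resD x n m) xy padic_resD.
  by apply: Bm; rewrite -(padic_resD x m n) addnC xy addnC padic_resD.
- by move=> A B AB [n An]; exists n => x y /An /AB.
Qed.

Fact padic_ent_refl A : padic_ent A -> diagonal `<=` A.
Proof. by move=> [n An] [x y] xy; apply: An; congr padic_res. Qed.

Fact padic_ent_inv A : padic_ent A -> padic_ent A^-1.
Proof. by move=> [n An]; exists n => x y xy; apply: An. Qed.

Fact padic_ent_split A :
  padic_ent A -> exists2 B, padic_ent B & B \; B `<=` A.
Proof.
move=> [n An]; exists [set xy : Zp * Zp | xy.1 n = xy.2 n]; first by exists n.
by move=> [x z] [y /= xy yz]; apply: An; rewrite xy yz.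
Qed.

HB.instance Definition _ := isUniform.Build (padic_int p_pr)
  padic_ent_filter padic_ent_refl padic_ent_inv padic_ent_split.

End PadicIntTopology.

Lemma padic_res_nat p (p_pr : prime p) (a n : nat) :
  (a%:R : padic_int p_pr) n = (a%:Z %% p%:Z ^+ n)%Z.
Proof.
elim: a => [|a IHa]; first by rewrite padic_res0 mod0z.
by rewrite -natr1 padic_res_add IHa /= modzDm -PoszD addn1.
Qed.

Lemma padic_res_eqP p (p_pr : prime p) (x y : padic_int p_pr) (n : nat) :
  x n = y n <-> exists z, x - y = p%:R ^+ n * z.
Proof.
have pn0 k : p%:Z ^+ k != 0 by rewrite expf_neq0 // eqz_nat -lt0n prime_gt0.
have resB k : ((x - y) k = (x k - y k) %% p%:Z ^+ k)%Z.
  by rewrite padic_res_add padic_res_opp modzDmr.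
split=> [xy|[z xyz]]; last first.
  have := resB n; rewrite xyz -natrX padic_res_mul padic_res_nat.
  rewrite -[((p ^ n)%N)%:Z]natz natrX natz modzz mul0r mod0z => /esym/eqP.
  by rewrite -dvdz_mod0E -eqz_mod_dvd !padic_res_mod => /eqP.
set d := x - y; have d0 : d n = 0 by rewrite resB xy subrr mod0z.
clearbody d.
have dD k : (p%:Z ^+ n %| d (n + k)%N)%Z by rewrite dvdz_mod0E padic_resD d0.
have zP k : ((d (n + k.+1)%N %/ p%:Z ^+ n)%Z =
             (d (n + k)%N %/ p%:Z ^+ n)%Z %[mod p%:Z ^+ k])%Z.
  apply/eqP; rewrite eqz_mod_dvd -(dvdz_mul2l (pn0 n)) mulrBr.
  rewrite ![p%:Z ^+ n * _]mulrC !divzK // -exprD -eqz_mod_dvd addnS [(k + n)%N]addnC.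
  by rewrite padic_resS padic_res_mod.
exists (padic_of p_pr zP); apply: padic_int_inj => k.
rewrite -natrX padic_res_mul padic_res_nat /= modzMml modzMmr.
by rewrite -[((p ^ n)%N)%:Z]natz natrX natz mulrC divzK // addnC padic_resD.
Qed.

Notation "x %:F" := (@FracField.tofrac _ x).
Notation padic p_pr := {fraction padic_int p_pr}.

Definition prelu p (p_pr : prime p) (x : padic p_pr) : padic p_pr :=
  if `[< exists z : padic_int p_pr, x = z%:F >] then x else 0.

Definition locally_constant (X : topologicalType) (Y : Type) (f : X -> Y) :=
  forall x : X, exists U : set X,
    [/\ open U, U x & forall y, U y -> f y = f x].

(* [network K din dout] consists of the parameters of the affine maps
   x |-> A x + b, from the input to the output; an activation function is
   applied after each of them but the last. *)
Inductive network (K : Type) : nat -> nat -> Type :=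
| OutputLayer din dout (A : 'M[K]_(dout, din)) (b : 'cV[K]_dout) :
    network K din dout
| HiddenLayer din d dout (A : 'M[K]_(d, din)) (b : 'cV[K]_d)
    (N : network K d dout) : network K din dout.

Fixpoint network_eval (K : pzRingType) (sigma : K -> K) din dout
    (N : network K din dout) : 'cV[K]_din -> 'cV[K]_dout :=
  match N with
  | OutputLayer _ _ A b => fun x => A *m x + b
  | HiddenLayer _ _ _ A b N' =>
      fun x => network_eval sigma N' (map_mx sigma (A *m x + b))
  end.

Fixpoint hidden_dims (K : Type) din dout (N : network K din dout) : seq nat :=
  match N with
  | OutputLayer _ _ _ _ => [::]
  | HiddenLayer _ d _ _ _ N' => d :: hidden_dims N'
  end.

Definition width (K : Type) din dout (N : network K din dout) : nat :=
  \max_(d <- hidden_dims N) d.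

(* Main.v *)
Require Import Defs.
From mathcomp Require Import all_boot all_order all_algebra.
From mathcomp Require Import all_classical topology generic_quotient.
Import Order.TTheory GRing.Theory Num.Theory.
Local Open Scope ring_scope.

(** By compactness f depends only on x mod p^n. A hidden layer of width d + 1
    can carry x in Z_p^d unchanged together with the value of
    pReLU ((x_i - c) / p^n + e), which is 0 outside the ball c + p^n Z_p; adding
    a multiple of it to x_i changes x on that ball only. With e = 0 such layers
    retract each residue ball onto its least representative, after which an
    affine map encodes x injectively as a positive integer below p^B, with
    base p^n digits. With e = 1 they move these integers, one at a time, to
    arbitrary multiples of p^B: a moved point is 0 mod p^B, hence is not
    touched again. A final scaling allows values with denominators. *)

(** * Digit expansions and affine precomposition *)

Lemma base_expansion_inj (b d : nat) (a c : 'I_d -> nat) :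
    (forall i, a i < b)%N -> (forall i, c i < b)%N ->
  (\sum_(i < d) a i * b ^ i = \sum_(i < d) c i * b ^ i)%N -> a =1 c.
Proof.
elim: d a c => [|d IH] a c a_lt c_lt; first by move=> _ [].
rewrite !big_ord_recl !expn0 !muln1.
have tailE (u : 'I_d.+1 -> nat) :
    (\sum_(i < d) u (lift ord0 i) * b ^ lift ord0 i =
     (\sum_(i < d) u (lift ord0 i) * b ^ i) * b)%N.
  by rewrite big_distrl; apply: eq_bigr => i _; rewrite /= -mulnA -expnSr.
rewrite !tailE => eq_ac.
have b_gt0 : (0 < b)%N by apply: leq_trans (a_lt ord0).
have eq0 : a ord0 = c ord0.
  move/(congr1 (modn^~ b)): eq_ac.
  by rewrite ![(_ + _ * b)%N]addnC !modnMDl !modn_small.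
have eqS : a \o lift ord0 =1 c \o lift ord0.
  apply: IH => [i|i|]; [exact: a_lt|exact: c_lt|].
  move: eq_ac; rewrite eq0 => /addnI/eqP.
  by rewrite eqn_pmul2r // => /eqP.
by move=> i; case: (unliftP ord0 i) => [j ->|->] //; apply: eqS.
Qed.

(** The affine map merges with the first affine map of [N], so pieces can be glued without a further
    hidden layer. *)
Lemma network_precomp (K : pzRingType) (d d' dout : nat) (A : 'M[K]_(d, d'))
    (b : 'cV[K]_d) (N : network K d dout) :
  exists N' : network K d' dout, hidden_dims N' = hidden_dims N /\
    forall (sigma : K -> K) x,
      network_eval sigma N' x = network_eval sigma N (A *m x + b).
Proof.
case: N A b => [din dout' A' b' A b|din d1 dout' A' b' N A b].
  exists (OutputLayer (A' *m A) (A' *m b + b')); split=> // sigma x /=.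
  by rewrite mulmxDr mulmxA addrA.
exists (HiddenLayer (A' *m A) (A' *m b + b') N); split=> // sigma x /=.
by rewrite mulmxDr mulmxA addrA.
Qed.

(** * Networks over Q_p that act on one residue ball per layer *)

Section PadicNetworks.
Variables (p : nat) (p_pr : prime p).
Local Notation Zp := (padic_int p_pr).
Local Notation Qp := (padic p_pr).
Local Notation embed := (map_mx (fun z : Zp => z%:F)).
Local Notation eval N x := (network_eval (@prelu p p_pr) N (embed x)).

Lemma prelu_tofrac (z : Zp) : prelu (z%:F) = z%:F.
Proof. by rewrite /prelu asboolT //; exists z. Qed.

Lemma embed_prelu (m n : nat) (x : 'M[Zp]_(m, n)) :
  map_mx (@prelu p p_pr) (embed x) = embed x.
Proof. by apply/matrixP => i j; rewrite !mxE prelu_tofrac. Qed.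

Lemma natp_expn_neq0 (n : nat) : (p%:R ^+ n : Zp) != 0.
Proof.
apply/eqP => /(congr1 (fun x : Zp => x n.+1)).
rewrite -natrX padic_res_nat padic_res0 => /eqP.
rewrite -dvdz_mod0E dvdzE abszX !absz_nat dvdn_Pexp2l ?prime_gt1 //.
by rewrite ltnn.
Qed.

(** Since [prelu] fixes Z_p, an identity block carries [x] through the layer beside the single
    neuron [u x + v]; the affine map that recombines them is absorbed into [N]. The [k] zero neurons
    pad the layer to an exact width. *)
Lemma skip_layer (d dout k : nat) (u : 'rV[Qp]_d) (v : 'cV[Qp]_1)
    (a : 'cV[Qp]_d) (N : network Qp d dout) :
  exists N' : network Qp d dout,
    hidden_dims N' = (d + 1 + k)%N :: hidden_dims N /\
    forall x : 'cV[Zp]_d, eval N' x =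
      network_eval (@prelu p p_pr) N
        (embed x + a *m map_mx (@prelu p p_pr) (u *m embed x + v)).
Proof.
have [N1 [dimN1 evalN1]] := network_precomp _ _ _ _
  (row_mx (row_mx 1%:M a) (0 : 'M_(d, k))) 0 N.
exists (HiddenLayer (col_mx (col_mx 1%:M u) (0 : 'M_(k, d)))
                    (col_mx (col_mx 0 v) 0) N1).
split=> [|x] /=; first by rewrite dimN1.
rewrite evalN1 !mul_col_mx !add_col_mx !map_col_mx !mul_row_col.
by rewrite !mul1mx mul0mx !addr0 embed_prelu.
Qed.

Lemma ball_step (d dout w n : nat) (i : 'I_d) (c a e : Zp)
    (N : network Qp d dout) : (d + 1 <= w)%N ->
  exists N' : network Qp d dout,
    [/\ hidden_dims N' = w :: hidden_dims N,
        forall (x : 'cV[Zp]_d) z, x i 0 - c = p%:R ^+ n * z ->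
          eval N' x = eval N (x + (a * (z + e)) *: delta_mx i 0) &
        forall x : 'cV[Zp]_d, x i 0 n <> c n -> eval N' x = eval N x].
Proof.
move=> /subnKC <-; move: (w - _)%N => k.
pose q : Qp := (p%:R ^+ n : Zp)%:F.
have q0 : q != 0 by rewrite tofrac_eq0 natp_expn_neq0.
have [N' [dimN' evalN']] := skip_layer d dout k (q^-1 *: delta_mx 0 i)
  (const_mx (e%:F - q^-1 * c%:F)) (a%:F *: delta_mx i 0) N.
have preE (x : 'cV[Zp]_d) :
    (q^-1 *: delta_mx 0 i : 'rV_d) *m embed x + const_mx (e%:F - q^-1 * c%:F) =
    const_mx ((q^-1 * (x i 0 - c)%:F) + e%:F).
  apply/matrixP => j l; rewrite -scalemxAl -rowE !mxE !ord1.
  by rewrite tofracB mulrBr addrCA addrC.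
exists N'; split=> // x => [z xz|xc]; rewrite evalN' preE.
  congr (network_eval _ N); apply/matrixP => j l.
  rewrite map_const_mx xz tofracM mulrA mulVf // mul1r -tofracD prelu_tofrac.
  rewrite -scalemxAl !mxE [RHS]tofracD big_ord1 !mxE !ord1 !eqxx !andbT.
  by case: eqP => _; rewrite ?mulr1 ?mul1r ?mul0r ?mulr0 ?tofracM ?tofrac0.
rewrite map_const_mx /prelu asboolF.
  by rewrite -[const_mx _]/(0 : 'M_1) mulmx0 addr0.
(* As [e] is integral, an integral argument [z] of the neuron would put [x i 0] in the ball around
   [c]. *)
move=> [z xz]; apply: xc; apply/padic_res_eqP; exists (z - e).
apply/eqP; rewrite -tofrac_eq tofracM [(z - e)%:F]tofracB -xz addrK mulrA mulfV //.
by rewrite mul1r.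
Qed.

Lemma padic_res_ge0 (x : Zp) n : 0 <= x n.
Proof.
rewrite -padic_res_mod modz_ge0 // expf_neq0 // eqz_nat -lt0n.
exact: prime_gt0.
Qed.

Lemma absz_padic_res_lt (x : Zp) n : (`|x n| < p ^ n)%N.
Proof.
rewrite -ltz_nat gez0_abs ?padic_res_ge0 // -padic_res_mod.
rewrite -[X in (_ < X)%R]natz natrX natz ltz_pmod //.
by rewrite exprn_gt0 // ltz_nat prime_gt0.
Qed.

Lemma padic_res_nat_small (c n : nat) : (c < p ^ n)%N -> (c%:R : Zp) n = c%:Z.
Proof.
move=> c_lt; rewrite padic_res_nat modz_small //=.
by rewrite -[p%:Z]natz -natrX natz.
Qed.

Definition padic_rep n (x : Zp) : Zp := `|x n|%N%:R.

Lemma padic_rep_nat (c n : nat) : (c < p ^ n)%N -> padic_rep n c%:R = c%:R.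
Proof. by move=> c_lt; rewrite /padic_rep padic_res_nat_small. Qed.

(** The list holds the pairs (coordinate, residue) still to be treated, one layer each. The
    hypothesis on [x] is the induction invariant; it holds for every [x] once [s] lists all
    pairs. *)
Lemma collapse_network (d dout w n : nat) (s : seq ('I_d * 'I_(p ^ n)))
    (N : network Qp d dout) : (d + 1 <= w)%N ->
  exists N' : network Qp d dout,
    hidden_dims N' = nseq (size s) w ++ hidden_dims N /\
    forall x : 'cV[Zp]_d,
      (forall j, padic_rep n (x j 0) = x j 0 \/
         exists2 c, (j, c) \in s & x j 0 n = (c%:R : Zp) n) ->
      eval N' x = eval N (map_mx (padic_rep n) x).
Proof.
move=> w_ge; elim: s => [|[i c] s [N1 [dimN1 evalN1]]].
  exists N; split=> // x x_rep; congr (network_eval _ N (embed _)).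
  by apply/matrixP => j k; rewrite !mxE ord1; case: (x_rep j) => // -[].
(* With [a = - p^n] and [e = 0] the added term is [- p^n z = c - x_i], which replaces [x_i] by
   [c]. *)
have [N2 [dimN2 inN2 outN2]] :=
  ball_step d dout w n i c%:R (- p%:R ^+ n) 0 N1 w_ge.
exists N2; split=> [|x x_rep]; first by rewrite dimN2 dimN1.
have [xc|xc] := eqVneq (x i 0 n) ((c%:R : Zp) n); last first.
  rewrite outN2; last exact/eqP.
  apply: evalN1 => j; case: (x_rep j) => [|[c' c's xc']]; first by left.
  right; exists c' => //; move: c's; rewrite inE => /orP[/eqP[ji c'c]|//].
  by rewrite -ji -c'c xc' eqxx in xc.
have [z xz] := (padic_res_eqP _ _ _).1 xc.
rewrite (inN2 _ _ xz) addr0 mulNr -xz opprB.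
set y := x + _.
have yE j : y j 0 = if j == i then c%:R else x j 0.
  rewrite /y !mxE eqxx andbT; case: eqP => [->|_].
    by rewrite mulr1 addrC subrK.
  by rewrite mulr0 addr0.
clearbody y; rewrite evalN1 => [|j].
  congr (network_eval _ N (embed _)); apply/matrixP => j k.
  rewrite !mxE ord1 yE; case: eqP => [->|//].
  by rewrite /padic_rep -xc.
rewrite yE; case: (eqVneq j i) => [_|ji]; first by left; apply: padic_rep_nat.
case: (x_rep j) => [|[c' c's xc']]; [by left|right; exists c' => //].
by move: c's; rewrite inE xpair_eqE (negPf ji).
Qed.

(** The clause on [y m = 0] strengthens the induction: the centres in [s] are nonzero mod [p^m]
    while the targets [u t] are zero, so later layers leave a moved point in place. *)
Lemma relocate_network (dout w m : nat) (u : nat -> Zp) (s : seq nat)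
    (N : network Qp 1 dout) : (2 <= w)%N -> (forall t, u t m = 0) ->
    {in s, forall t, 0 < t < p ^ m}%N ->
  exists N' : network Qp 1 dout,
    [/\ hidden_dims N' = nseq (size s) w ++ hidden_dims N,
        forall y : Zp, y m = 0 -> eval N' (const_mx y) = eval N (const_mx y) &
        forall t, (t < p ^ m)%N -> eval N' (const_mx t%:R) =
          eval N (const_mx (if t \in s then u t else t%:R))].
Proof.
move=> w_ge um; elim: s => [|t0 s IH] s_lt; first by exists N.
have {IH}[|N1 [dimN1 zeroN1 evalN1]] := IH.
  by move=> t ts; apply: s_lt; rewrite inE ts orbT.
have /andP[t0_gt0 t0_lt] := s_lt t0 (mem_head _ _).
(* At [t0] itself [z = 0], so [e = 1] makes the shift exactly [u t0 - t0]; the other integers below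
   [p^m] lie outside this ball. *)
have [N2 [dimN2 inN2 outN2]] :=
  ball_step 1 dout w m 0 t0%:R (u t0 - t0%:R) 1 N1 w_ge.
exists N2; split=> [|y ym|t t_lt]; first by rewrite dimN2 dimN1.
  rewrite outN2 ?zeroN1 // mxE ym padic_res_nat_small //.
  by move=> [t00]; rewrite -t00 in t0_gt0.
rewrite inE; have [->|tt0] /= := eqVneq t t0.
  rewrite (inN2 _ 0); last by rewrite mxE subrr mulr0.
  rewrite add0r mulr1 -zeroN1 //; congr (network_eval _ N1 (embed _)).
  by apply/matrixP => j k; rewrite !mxE !ord1 !eqxx mulr1 addrC subrK.
rewrite outN2 ?evalN1 // mxE !padic_res_nat_small // => -[] /eqP.
exact/negP.
Qed.

End PadicNetworks.

(** * Finiteness: common denominators and a uniform level of local constancy *)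

Lemma bigmax_nseq (k w : nat) : (0 < k)%N -> \max_(d <- nseq k w) d = w.
Proof.
case: k => // k _; elim: k => [|k IH]; first by rewrite big_seq1.
by rewrite big_cons IH maxnn.
Qed.

Lemma fraction_common_denom (R : idomainType) (v : nat -> {fraction R}) (B : nat) :
  exists2 b : R, b != 0 & exists z : nat -> R,
    forall t, (t < B)%N -> b%:F * v t = (z t)%:F.
Proof.
suff [b b0 bP] : exists2 b : R, b != 0 &
    forall t, exists z : R, (t < B)%N -> b%:F * v t = z%:F.
  by exists b => //; have [z zP] := choice bP; exists z.
elim: B => [|B [b b0 bP]].
  by exists 1 => [|t]; [exact: oner_neq0 | exists 0; rewrite ltn0].
have [d d0 [c dc]] : exists2 d : R, d != 0 & exists c : R, d%:F * v B = c%:F.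
  elim/quotW: (v B) => r; exists r.2; first exact: denom_ratioP.
  exists r.1; rewrite -[LHS]/(FracField.mul _ _) !piE; apply/eqmodP.
  rewrite /= FracField.equivfE /FracField.mulf.
  by rewrite !numden_Ratio ?(oner_eq0, mulf_neq0, denom_ratioP) // !mul1r !mulr1.
exists (b * d) => [|t]; first exact: mulf_neq0.
have [z zP] := bP t; have [tB|Bt|->] := ltngtP t B.
- by exists (z * d) => _; rewrite tofracM mulrAC zP // -tofracM.
- by exists 0; rewrite ltnS leqNgt Bt.
- by exists (b * c) => _; rewrite tofracM -mulrA dc -tofracM.
Qed.

(* Koenig's lemma on the tree of residue classes: if no level worked, some
   nested sequence of bad classes would shrink to a bad point. *)
Lemma locally_constant_residue (p : nat) (p_pr : prime p) (d : nat) (Y : Type)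
    (f : 'cV[padic_int p_pr]_d -> Y) : locally_constant f ->
  exists n, forall x y : 'cV[padic_int p_pr]_d,
    (forall i, x i 0 n = y i 0 n) -> f x = f y.
Proof.
move=> f_lc.
pose near n (x y : 'cV[padic_int p_pr]_d) := forall i, x i 0 n = y i 0 n.
pose good n x := exists m, forall y z, near n y x -> near m y z -> f y = f z.
(* There is a single class modulo [p^0], so goodness at level 0 is the claim. *)
suff [m mP] : good 0%N 0.
  exists m => x y xy; apply: mP => // i.
  by apply/padic_res_eqP; exists (x i 0 - (0 : 'cV_d) i 0); rewrite mul1r.
have nearS n x y : near n.+1 x y -> near n x y.
  by move=> xy i; rewrite -(padic_resS (x i 0)) -(padic_resS (y i 0)) xy.
have nearM k m (y z : 'cV_d) : near (m + k)%N y z -> near m y z.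
  by move=> yz i; rewrite -(padic_resD (y i 0) m k) yz padic_resD.
have good_child n x : (forall y, near n y x -> good n.+1 y) -> good n x.
  move=> gx.
  (* A class has finitely many subclasses at the next level, indexed by the vectors [reps c], so the
     largest of their levels [M c] serves for the whole class. *)
  pose reps (c : {ffun 'I_d -> 'I_(p ^ n.+1)}) : 'cV[padic_int p_pr]_d :=
    \col_i (c i)%:R.
  have [M MP] : exists M : {ffun 'I_d -> 'I_(p ^ n.+1)} -> nat, forall c y z,
      near n y x -> near n.+1 y (reps c) -> near (M c) y z -> f y = f z.
    suff /choice[M MP] : forall c, exists m, forall y z,
      near n y x -> near n.+1 y (reps c) -> near m y z -> f y = f z by exists M.
    move=> c; have [[y [yx yc]]|noy] := pselect (exists y, near n y x /\ near n.+1 y (reps c)).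
      have [m mP] := gx y yx; exists m => u v ux uc uv.
      by apply: (mP u v) => // i; rewrite uc yc.
    by exists 0%N => y z yx yc; case: noy; exists y.
  exists (\max_c M c)%N => y z yx yz.
  have y_lt i : (`|y i 0%R n.+1| < p ^ n.+1)%N := absz_padic_res_lt p p_pr _ _.
  pose c := [ffun i => Ordinal (y_lt i)].
  apply: (MP c y z yx) => [i|].
    by rewrite mxE ffunE padic_res_nat_small // gez0_abs ?padic_res_ge0.
  apply: (nearM (\max_c M c - M c)%N); rewrite subnKC //.
  exact: leq_bigmax.
apply: contrapT => bad0.
pose bad n := {x | ~ good n x}.
have bad_child n (x : bad n) : {y : bad n.+1 | near n (sval y) (sval x)}.
  apply: cid; apply: contrapT => noy; case: x noy => x bx noy.
  apply: (bx); apply: good_child => y yx; apply: contrapT => gy.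
  by apply: noy; exists (exist _ y gy).
pose fix path n : bad n :=
  if n is m.+1 then sval (bad_child m (path m)) else exist _ 0 bad0.
have pathS n : near n (sval (path n.+1)) (sval (path n)).
  exact: (svalP (bad_child n (path n))).
have lim_compat i n : (sval (path n.+1) i 0%R n.+1 =
    sval (path n) i 0%R n %[mod p%:Z ^+ n])%Z.
  by rewrite padic_resS pathS padic_res_mod.
(* The residues along the bad path are compatible and define a point lying in all of its classes. *)
pose x : 'cV_d := \col_i padic_of p_pr (lim_compat i).
have xpath n : near n x (sval (path n)).
  by move=> i; rewrite mxE /= padic_res_mod.
have [U [Uo Ux Uf]] := f_lc x.
have [k kU] : exists k, forall y, near k x y -> U y.
  (* Neighbourhoods of a matrix are entrywise, so the maximum of the entry levels gives a residue
     class inside [U]. *)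
  have [P nbhsP sPU] : nbhs x U by apply: open_nbhs_nbhs.
  have /choice[k kP] : forall i, exists k, forall t : padic_int p_pr,
      x i 0 k = t k -> P i 0 t.
    move=> i; have := nbhsP i 0; rewrite -nbhs_entourageE => -[E [k Ek] sEP].
    by exists k => t xt; apply: sEP; apply/xsectionP; apply: Ek.
  exists (\max_i k i)%N => y xy; apply: sPU => i j; rewrite ord1; apply: kP.
  by apply: (nearM (\max_i k i - k i)%N) => l; rewrite subnKC ?xy // leq_bigmax.
(* The class of [path k] lies in [U], where [f] is constant, so it is good, against its choice. *)
apply: (svalP (path k)); exists k => y z yx yz.
have xy : near k x y by move=> i; rewrite xpath yx.
rewrite (Uf y); last exact: kU.
by rewrite (Uf z) //; apply: kU => i; rewrite xy yz.
Qed.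


(** * Assembly of the network: collapse, encode, relocate, rescale *)

Theorem theorem3p4 (p : nat) (p_pr : prime p) (dx : nat) (dx_gt0 : (0 < dx)%N)
    (w : nat) (w_ge : (dx + 1 <= w)%N)
    (f : 'cV[padic_int p_pr]_dx -> padic p_pr) (f_lc : locally_constant f) :
  exists g : network (padic p_pr) dx 1,
    width g = w /\
    forall x : 'cV[padic_int p_pr]_dx,
      network_eval (@prelu p p_pr) g (map_mx (fun z => z%:F) x) ord0 ord0 = f x.
Proof.
have [n fn] := locally_constant_residue p p_pr dx _ f f_lc.
pose b := (p ^ n)%N.
(* The successor keeps codes positive: the class of 0 mod [p^B] is reserved for moved points. *)
pose code (x : 'cV[padic_int p_pr]_dx) := (\sum_(i < dx) `|x i 0%R n| * b ^ i).+1.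
(* [B] exceeds every code and also serves as the exponent, since [B < p^B]. *)
pose B := (\sum_(i < dx) b * b ^ i).+2.
have code_lt x : (code x < B)%N.
  rewrite !ltnS; apply: leq_sum => i _; rewrite leq_mul2r ltnW ?orbT //.
  exact: absz_padic_res_lt.
have code_inj x y : code x = code y -> f x = f y.
  move=> [] /base_expansion_inj xy; apply: fn => i.
  rewrite -[LHS]gez0_abs ?padic_res_ge0 // -[RHS]gez0_abs ?padic_res_ge0 //.
  by rewrite xy // => j; exact: absz_padic_res_lt.
have B_lt t : (t < B -> t < p ^ B)%N.
  by move=> tB; apply: ltn_trans tB _; apply: ltn_expl; apply: prime_gt1.
have [v vP] : exists v : nat -> padic p_pr, forall x, v (code x) = f x.
  suff /choice[v vP] : forall t, exists q, forall x, code x = t -> f x = q.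
    by exists v => x; rewrite -(vP _ x).
  move=> t; have [[y <-]|noy] := pselect (exists y, code y = t).
    by exists (f y) => x; apply: code_inj.
  by exists 0 => x xt; case: noy; exists x.
have [a a0 [z zP]] := fraction_common_denom _ v B.
(* The targets [u t = p^B z t] below are integral and 0 mod [p^B]; dividing by [q] in the output
   layer gives [z t / a = v t] for [t < B]. *)
pose q : padic p_pr := (p%:R ^+ B * a)%:F.
have q0 : q != 0 by rewrite tofrac_eq0 mulf_neq0 // natp_expn_neq0.
pose u t := p%:R ^+ B * z t.
have uB t : u t B = 0.
  rewrite -(padic_res0 p_pr B); apply/padic_res_eqP.
  by exists (z t); rewrite subr0.
have w_ge2 : (2 <= w)%N by apply: leq_trans w_ge; rewrite addn1.
have [|N1 [dimN1 _ evalN1]] := relocate_network p p_pr 1 w B u (iota 1 B.-1)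
  (OutputLayer (q^-1)%:M 0) w_ge2 uB.
  by move=> t; rewrite mem_iota => /andP[-> /B_lt].
have [N2 [dimN2 evalN2]] :=
  network_precomp (padic p_pr) 1 dx 1 (\row_i (b%:R ^+ i : padic_int p_pr)%:F)
  (const_mx 1) N1.
have [N3 [dimN3 evalN3]] := collapse_network p p_pr dx 1 w n
  (enum {: 'I_dx * 'I_b}) N2 w_ge.
exists N3; split=> [|x].
  (* [B >= 2], so there is at least one hidden layer and the maximum is [w] rather than the empty
     value 0. *)
  rewrite /width dimN3 dimN2 dimN1 cats0 -nseqD bigmax_nseq //.
  by rewrite size_iota addnS.
rewrite evalN3; last first.
  move=> j; right; exists (Ordinal (absz_padic_res_lt p p_pr (x j 0) n)).
    by rewrite mem_enum.
  by rewrite padic_res_nat_small ?gez0_abs ?padic_res_ge0 // absz_padic_res_lt.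
rewrite evalN2.
(* Collapsed coordinates are the natural numbers that [code] uses as base [b] digits. *)
have -> : \row_i (b%:R ^+ i : padic_int p_pr)%:F *m
      map_mx (fun z => z%:F) (map_mx (padic_rep p p_pr n) x) + const_mx 1 =
    map_mx (fun z : padic_int p_pr => z%:F) (const_mx (code x)%:R).
  apply/matrixP => j k; rewrite !mxE /code -natr1 natr_sum tofracD tofrac1.
  rewrite rmorph_sum; congr (_ + _); apply: eq_bigr => i _.
  by rewrite !mxE ord1 natrM natrX rmorphM mulrC.
rewrite evalN1 ?B_lt // mem_iota code_lt /=.
rewrite addr0 mul_scalar_mx !mxE /u tofracM -zP // [_%:F * _]mulrA -tofracM.
by rewrite mulKf ?vP.
Qed.
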